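(* Let $d\ge 1$, let $\mathbb T^d=\mathbb R^d/2\pi\mathbb Z^d$, let $T>0$, and assume $h\in C_t^1C_x^2([0,T]\times\mathbb T^d)$ (real-valued) is a classical solution to $$\partial_t h=\nabla\cdot\bigl((|\nabla h|^2-1)\nabla h\bigr).$$ Then $$\|\nabla h(t,\cdot)\|_\infty\le \max\{\|\nabla h(0,\cdot)\|_\infty,\,1\},\qquad \forall\,0\le t\le T.$$ If the dimension $d=1$, then the better bound $$\|\partial_x h(t,\cdot)\|_\infty\le \max\Bigl\{\|\partial_x h(0,\cdot)\|_\infty,\,\frac1{\sqrt3}\Bigr\},\qquad \forall\,0\le t\le T,$$ holds.
   Context: $\mathbb T^d$ is the $2\pi$-periodic torus. $\|\cdot\|_\infty$ is the $L^\infty(\mathbb T^d)$ norm in $x$, and $|\nabla h|$ is the Euclidean length of the spatial gradient. $C_t^1C_x^2$ denotes functions that are $C^1$ in time with values in $C^2(\mathbb T^d)$. *)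

(* Defs.v *)
From HB Require Import structures.
From mathcomp Require Import all_boot all_order all_algebra.
From mathcomp Require Import all_classical all_reals all_analysis.

Set Implicit Arguments.
Unset Strict Implicit.
Unset Printing Implicit Defensive.

Import Order.TTheory GRing.Theory Num.Theory.
Import numFieldNormedType.Exports.

Local Open Scope classical_set_scope.
Local Open Scope ring_scope.

(* Functions on the torus R^d / 2 pi Z^d are the functions on R^d that are     *)
(* 2 pi-periodic in each coordinate.                                          *)
Definition periodic (R : realType) (d : nat) (f : 'rV[R]_d -> R) : Prop :=
  forall (x : 'rV[R]_d) (i : 'I_d), f (x + (2 * pi) *: delta_mx 0 i) = f x.

Definition partial (R : realType) (d : nat) (i : 'I_d) (f : 'rV[R]_d -> R) :
  'rV[R]_d -> R := fun x => 'D_(delta_mx 0 i) f x.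

Definition grad (R : realType) (d : nat) (f : 'rV[R]_d -> R) (x : 'rV[R]_d) :
  'rV[R]_d := \row_i partial i f x.

Definition divergence (R : realType) (d : nat) (F : 'rV[R]_d -> 'rV[R]_d)
  (x : 'rV[R]_d) : R := \sum_(i < d) partial i (fun y => F y 0 i) x.

(* The library norm on 'rV[R]_d is the max norm. *)
Definition enorm (R : realType) (d : nat) (v : 'rV[R]_d) : R :=
  Num.sqrt (\sum_(i < d) v 0 i ^+ 2).

Fixpoint is_Ck (R : realType) (d k : nat) (f : 'rV[R]_d -> R) : Prop :=
  continuous f /\
  if k is k'.+1 then
    forall i : 'I_d,
      (forall x, derivable f x (delta_mx 0 i)) /\ is_Ck k' (partial i f)
  else True.

Definition C2_torus (R : realType) (d : nat) (f : 'rV[R]_d -> R) : Prop :=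
  periodic f /\ is_Ck 2 f.

(* [sup] of an unbounded set is 0; these norms are only applied to functions  *)
(* in [C2_torus], for which the suprema are finite.                           *)
Definition supnorm (R : realType) (d : nat) (f : 'rV[R]_d -> R) : R :=
  sup (range (fun x => `|f x|)).

Definition C2norm (R : realType) (d : nat) (f : 'rV[R]_d -> R) : R :=
  supnorm f + \sum_(i < d) supnorm (partial i f)
  + \sum_(i < d) \sum_(j < d) supnorm (partial i (partial j f)).

Definition diff_quot (R : realType) (d : nat) (h : R -> 'rV[R]_d -> R)
  (t s : R) (x : 'rV[R]_d) : R := (s - t)^-1 * (h s x - h t x).

(* Time derivative on [0, T], one-sided at the endpoints. *)
Definition dt (R : realType) (d : nat) (T : R) (h : R -> 'rV[R]_d -> R)
  (t : R) (x : 'rV[R]_d) : R :=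
  lim (diff_quot h t s x @[s --> within `[0, T] t^']).

(* C^1([0, T]; C^2(T^d)): [dt T h] is the derivative of t |-> h t with respect *)
(* to the C^2 norm, and it is continuous in t for that norm.                  *)
Definition C1_C2 (R : realType) (d : nat) (T : R) (h : R -> 'rV[R]_d -> R) :
    Prop :=
  forall t : R, t \in `[0, T] ->
    [/\ C2_torus (h t),
        C2_torus (dt T h t),
        C2norm (diff_quot h t s \- dt T h t) @[s --> within `[0, T] t^'] --> 0
      & C2norm (dt T h s \- dt T h t) @[s --> within `[0, T] t^'] --> 0].

Definition classical_solution (R : realType) (d : nat) (T : R)
  (h : R -> 'rV[R]_d -> R) : Prop :=
  forall (t : R) (x : 'rV[R]_d), t \in `[0, T] ->
    dt T h t x =
    divergence (fun y => (enorm (grad (h t) y) ^+ 2 - 1) *: grad (h t) y) x.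

Definition cons_pair (R : realType) (n : nat)
  (p : measurableTypeR R * n.-tuple (measurableTypeR R)) :
  n.+1.-tuple (measurableTypeR R) := [tuple of p.1 :: p.2].

Lemma measurable_cons_pair (R : realType) (n : nat) :
  measurable_fun setT (@cons_pair R n).
Proof. exact: measurable_cons. Qed.

HB.instance Definition _ (R : realType) (n : nat) :=
  isMeasurableFun.Build _ _ _ _ (@cons_pair R n) (@measurable_cons_pair R n).

Lemma two_pi_gt0 (R : realType) : (0 : R) < 2 * pi.
Proof. by rewrite mulr_gt0// pi_gt0. Qed.

(* Lebesgue measure on the fundamental domain [0, 2 pi]^d, normalised to total *)
(* mass 1 (which does not affect the L^oo norm), as an iterated product.      *)
Fixpoint torus_measure (R : realType) (d : nat) :
    probability (d.-tuple (measurableTypeR R)) R :=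
  match d with
  | 0 => \d_[tuple]
  | n.+1 =>
    distribution (uniform_prob (two_pi_gt0 R) \x torus_measure R n)%E
      (@cons_pair R n)
  end.

Definition Linfty (R : realType) (d : nat) (f : 'rV[R]_d -> R) : \bar R :=
  Lnorm (torus_measure R d) +oo%E (fun u => (f (\row_i tnth u i))%:E).

(* Main.v *)
Require Import Defs.
From mathcomp Require Import all_boot all_order all_algebra.
From mathcomp Require Import all_classical all_reals all_analysis.
From mathcomp Require Import ess_sup_inf.
From mathcomp Require Import ring lra.
Import Defs.

Set Implicit Arguments.
Unset Strict Implicit.
Unset Printing Implicit Defensive.

Import Order.TTheory GRing.Theory Num.Theory.
Import numFieldNormedType.Exports.

Local Open Scope classical_set_scope.
Local Open Scope ring_scope.

(** The proof doubles the space variable. Expanding the divergence, the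
    equation reads [dt h = A(p) : D^2 h] with [p = grad h] and
    [A(p) = (|p|^2 - 1) I + 2 p p^T]. The matrix [A(p)] is nonnegative as soon
    as [|p| >= 1]; in dimension one it is the number [3 p^2 - 1], which is
    nonnegative as soon as [|p| >= 1 / sqrt 3]. Write [c] for this threshold,
    and let [L] be the maximum of [c] and of the supremum of [|grad h(0)|]. It
    suffices to show that [h(t)] stays [L]-Lipschitz
    ([lipschitz_propagation]). Fix [e > 0] and consider
    [Phi(t, x, z) = h(t, x + z) - h(t, x) - L |z| - e t]. By periodicity and
    compactness [Phi] attains its maximum ([doubled_max]). Suppose that this
    maximum is positive. It is then attained at some [(t, x, z)] with [t > 0],
    because [h(0)] is [L]-Lipschitz, and with [z != 0]. At such a point:

    - maximality in [x] with [z] fixed makes the gradients of [h(t)] at [x + z]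
      and [x] equal to a common vector [p], and makes
      [D^2 h(x + z) - D^2 h(x)] nonpositive ([doubling_max_translate]);
    - maximality in [z], tested by shrinking [z], gives [|p| >= L]
      ([doubling_max_slope]), so [A(p)] is nonnegative;
    - maximality in [t] gives [dt h(x + z) - dt h(x) >= e] ([dt_ge_at_max]).

    The first two facts and the equation give
    [dt h(x + z) - dt h(x) = A(p) : (D^2 h(x + z) - D^2 h(x)) <= 0], which
    contradicts the third. Both Hessians are taken at the same time and
    contracted with the same [A(p)], so no third derivative of [h] appears: the
    equation is never differentiated, and two space derivatives suffice.

    Two facts connect this argument to the statement. A function with
    continuous partial derivatives has all its directional derivatives, given by
    the gradient ([C1_derive]); this supplies the second-order test in every
    direction and the passage between gradient bounds and Lipschitz bounds. And
    the essential supremum of a continuous periodic function bounds it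
    pointwise, since boxes have positive measure ([le_Linfty]). *)

(** * Directional derivatives of C^1 functions *)

Lemma is_derive_line (R : realType) (d : nat) (f : 'rV[R]_d -> R)
    (y v : 'rV[R]_d) (s df : R) :
  is_derive (y + s *: v) v f df ->
  is_derive s 1 (fun r : R => f (y + r *: v)) df.
Proof.
have E : (fun h : R => h^-1 *: (f (y + (h *: 1 + s) *: v) - f (y + s *: v)))
     = (fun h => h^-1 *: (f (h *: v + (y + s *: v)) - f (y + s *: v))).
  apply/funext => h; congr (_ *: (f _ - _)).
  by rewrite [h *: 1]mulr1 scalerDl addrCA.
by case=> D1 D2; split; rewrite /derivable /derive /= E.
Qed.

Lemma line_mean_value (R : realType) (d : nat) (f : 'rV[R]_d -> R)
    (df : 'rV[R]_d -> R) (y v : 'rV[R]_d) (s : R) :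
  (forall x, is_derive x v f (df x)) ->
  exists2 r : R, `|r| <= `|s| & f (y + s *: v) - f y = s * df (y + r *: v).
Proof.
move=> Df; pose g r := f (y + r *: v).
have Dg (r : R) : is_derive r 1 g (df (y + r *: v)) by exact: is_derive_line.
have cg (a b : R) : {within `[a, b], continuous g}.
  apply: continuous_subspaceT => r; apply: differentiable_continuous.
  by apply/derivable1_diffP; case: (Dg r).
have g0 : g 0 = f y by rewrite /g scale0r addr0.
rewrite -g0 -/(g s); have [s0|s0] := leP 0 s.
  have [r] := @MVT_segment R g _ 0 s s0 (fun x _ => Dg x) (cg _ _).
  rewrite in_itv /= => /andP[r0 rs] ->; exists r; last by rewrite subr0 mulrC.
  by rewrite !ger0_norm.
have [r] := @MVT_segment R g _ s 0 (ltW s0) (fun x _ => Dg x) (cg _ _).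
rewrite in_itv /= => /andP[r0 rs] E; exists r.
  by rewrite ler0_norm// ler0_norm ?lerN2// ltW.
by apply: oppr_inj; rewrite opprB E sub0r mulrN mulrC.
Qed.

(** The base point moves together with the increment. This uniformity is what
    makes the notion additive in the direction, which plain directional
    derivatives are not. *)
Definition strict_derive (R : realType) (d : nat) (f : 'rV[R]_d -> R)
    (x v : 'rV[R]_d) (l : R) : Prop :=
  forall e : R, 0 < e -> exists2 r : R, 0 < r &
    forall (y : 'rV[R]_d) (s : R), `|y - x| < r -> `|s| < r ->
      `|f (y + s *: v) - f y - s * l| <= e * `|s|.

(** The increment along [v + w] is the increment along [w] based at [y + s v]
    plus the one along [v] based at [y]; the shifted base point still lies in
    the neighbourhood where the second expansion is uniform. *)
Lemma strict_deriveD (R : realType) (d : nat) (f : 'rV[R]_d -> R)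
    (x v w : 'rV[R]_d) (l m : R) :
  strict_derive f x v l -> strict_derive f x w m ->
  strict_derive f x (v + w) (l + m).
Proof.
move=> Dv Dw e e0.
have [r r0 Hv] := Dv (e / 2) ltac:(lra).
have [q q0 Hw] := Dw (e / 2) ltac:(lra).
have v1 : 0 < `|v| + 1 by have := normr_ge0 v; lra.
exists (Num.min r (Num.min (q / 2) (q / 2 / (`|v| + 1)))).
  by rewrite !lt_min r0 !divr_gt0.
move=> y s; rewrite !lt_min => /and3P[y1 y2 y3] /and3P[s1 s2 s3].
have Ev := Hv y s y1 s1.
have sq : `|s| < q by lra.
have yq : `|y + s *: v - x| < q.
  rewrite addrAC; apply: le_lt_trans (ler_normD _ _) _; rewrite normrZ.
  move: s3; rewrite ltr_pdivlMr// => s3.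
  have := normr_ge0 s; nra.
have Ew := Hw _ _ yq sq.
rewrite scalerDr addrA.
have -> : f (y + s *: v + s *: w) - f y - s * (l + m)
  = (f (y + s *: v) - f y - s * l)
    + (f (y + s *: v + s *: w) - f (y + s *: v) - s * m) by ring.
by apply: le_trans (ler_normD _ _) _; lra.
Qed.

Lemma strict_deriveZ (R : realType) (d : nat) (f : 'rV[R]_d -> R)
    (x v : 'rV[R]_d) (c l : R) :
  strict_derive f x v l -> strict_derive f x (c *: v) (c * l).
Proof.
move=> Dv e e0.
have c1 : 0 < `|c| + 1 by have := normr_ge0 c; lra.
have [r r0 Hv] := Dv (e / (`|c| + 1)) (divr_gt0 e0 c1).
exists (Num.min r (r / (`|c| + 1))); first by rewrite lt_min r0 divr_gt0.
move=> y s; rewrite !lt_min => /andP[y1 y2] /andP[s1 s2].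
have sc : `|s * c| < r.
  rewrite normrM; move: s2; rewrite ltr_pdivlMr// => s2.
  have := normr_ge0 s; have := normr_ge0 c; nra.
rewrite scalerA mulrA; apply: le_trans (Hv _ _ y1 sc) _.
rewrite normrM mulrAC ler_pdivrMr//.
have := normr_ge0 s; have := normr_ge0 c.
by move=> c0 s0; rewrite -!mulrA ler_pM2l// ler_wpM2l//; lra.
Qed.

(** The mean value theorem rewrites the increment as [s] times the partial
    derivative at a nearby point; continuity does the rest. *)
Lemma strict_derive_partial (R : realType) (d : nat) (f : 'rV[R]_d -> R)
    (i : 'I_d) (x : 'rV[R]_d) :
  (forall y, derivable f y (delta_mx 0 i)) -> {for x, continuous (partial i f)} ->
  strict_derive f x (delta_mx 0 i) (partial i f x).
Proof.
move=> Df cf e e0.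
have /cvgrPdist_lt/(_ e e0)/nbhs_ballP[r /= r0 Hr] := cf.
pose D := `|delta_mx 0 i : 'rV[R]_d|.
have D1 : 0 < D + 1 by have : 0 <= D := normr_ge0 _; lra.
exists (Num.min (r / 2) (r / 2 / (D + 1))); first by rewrite lt_min !divr_gt0.
move=> y s; rewrite !lt_min => /andP[y1 y2] /andP[s1 s2].
have [q qs ->] := @line_mean_value R d f (partial i f) y (delta_mx 0 i) s
  (fun z => derivableP (Df z)).
rewrite -mulrBr normrM mulrC ler_wpM2r// distrC; apply/ltW/Hr.
rewrite -ball_normE /= distrC addrAC.
apply: le_lt_trans (ler_normD _ _) _; rewrite normrZ -/D.
move: s2; rewrite ltr_pdivlMr// => s2.
have := normr_ge0 s; have : 0 <= D := normr_ge0 _; nra.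
Qed.

Lemma strict_derive_is_derive (R : realType) (d : nat) (f : 'rV[R]_d -> R)
    (x v : 'rV[R]_d) (l : R) :
  strict_derive f x v l -> is_derive x v f l.
Proof.
move=> Dv.
have H : (fun h : R => h^-1 *: (f (h *: v + x) - f x)) @ 0^' --> l.
  apply/cvgrPdist_le => e e0; have [r r0 Hr] := Dv e e0.
  apply/nbhs_ballP; exists r => //= s /=; rewrite -ball_normE /= sub0r normrN.
  move=> sr s0; have s_gt0 : 0 < `|s| by rewrite normr_gt0.
  have := Hr x s; rewrite subrr normr0 [x + _]addrC => /(_ r0 sr) H.
  rewrite distrC -(ler_pM2r s_gt0) -normrM; apply: le_trans H.
  by rewrite [_ *: _]mulrC mulrBl divfK -?normr_gt0// [l * s]mulrC.
split; first by apply/cvg_ex; exists l.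
exact: cvg_lim H.
Qed.

(** The direction is a combination of the coordinate vectors, along each of
    which the derivative is strict. *)
Lemma C1_derive (R : realType) (d : nat) (f : 'rV[R]_d -> R)
    (x v : 'rV[R]_d) :
  is_Ck 1 f -> is_derive x v f (\sum_i v 0 i * partial i f x).
Proof.
move=> [_ Cf]; apply: strict_derive_is_derive.
rewrite {1}(row_sum_delta v).
elim/big_rec2 : _ => [|i l w _ Dw].
  move=> e e0; exists 1 => // y s _ _.
  by rewrite scaler0 addr0 subrr sub0r mulr0 oppr0 normr0 mulr_ge0// ltW.
apply: strict_deriveD => //; apply: strict_deriveZ.
have [Df [cf _]] := Cf i; apply: strict_derive_partial; first exact: Df.
exact: cf.
Qed.

(** If [c] were positive, [dg] would be positive just to the right of [0], and
    [g] would exceed [g 0] there. *)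
Lemma second_derive_at_max (R : realType) (g dg : R -> R) (c : R) :
  (forall s : R, is_derive s 1 g (dg s)) -> is_derive (0 : R) 1 dg c ->
  (forall s, g s <= g 0) -> dg 0 = 0 /\ c <= 0.
Proof.
move=> Dg Ddg gmax.
have dg0 : dg 0 = 0.
  have [D E] := @derive1_at_max R g (-1) 1 0 ltac:(lra)
    (fun t _ => @ex_derive _ _ _ _ _ _ _ (Dg t))
    ltac:(by rewrite in_itv /=; apply/andP; split; lra) (fun t _ => gmax t).
  by rewrite -(@derive_val _ _ _ _ _ _ _ (Dg 0)).
split=> //; rewrite leNgt; apply/negP => c0.
have [D E] := Ddg.
have : (fun h : R => h^-1 *: (dg (h *: 1 + 0) - dg 0)) @ 0^' --> c.
  by rewrite -E; exact: D.
move/cvgrPdist_lt => /(_ c c0)/nbhs_ballP[r /= r0 Hr].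
have dgpos s : 0 < s -> s < r -> 0 < dg s.
  move=> s0 sr; have := Hr s; rewrite -ball_normE /= sub0r normrN gtr0_norm//.
  move=> /(_ sr); rewrite gt_eqF// => /(_ isT).
  rewrite addr0 [_ *: 1]mulr1 dg0 subr0 ltr_norml => /andP[_ H].
  have : 0 < s^-1 * dg s by move: H; rewrite ltrBlDl ltrDr.
  by rewrite pmulr_rgt0// invr_gt0.
have cg : {within `[0, r / 2], continuous g}.
  apply: continuous_subspaceT => s; apply: differentiable_continuous.
  by apply/derivable1_diffP; case: (Dg s).
have [s] := @MVT R g dg 0 (r / 2) ltac:(lra) (fun s _ => Dg s) cg.
rewrite in_itv /= => /andP[s0 sr] E2.
have := gmax (r / 2); have := dgpos s s0 ltac:(lra).
by rewrite subr0 in E2; nra.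
Qed.

(** * Periodic functions and the supremum norm *)

Lemma periodic_int (R : realType) (d : nat) (f : 'rV[R]_d -> R)
    (k : 'I_d -> int) (x : 'rV[R]_d) :
  periodic f -> f (x + \row_i (2 * pi * (k i)%:~R)) = f x.
Proof.
move=> pf.
have pn (i : 'I_d) (n : nat) (y : 'rV[R]_d) :
    f (y + (2 * pi * n%:R) *: delta_mx 0 i) = f y.
  elim: n y => [|n IH] y; first by rewrite mulr0 scale0r addr0.
  by rewrite -(natr1 n) mulrDr mulr1 scalerDl addrA pf IH.
have pz (i : 'I_d) (m : int) (y : 'rV[R]_d) :
    f (y + (2 * pi * m%:~R) *: delta_mx 0 i) = f y.
  case: m => n; first exact: pn.
  rewrite NegzE mulrNz mulrN scaleNr.
  by rewrite -[LHS](pn i n.+1) subrK.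
rewrite (row_sum_delta (\row_i _)).
elim/big_rec : _ x => [|i l _ IH] y; first by rewrite addr0.
by rewrite addrA IH mxE pz.
Qed.

(** The interval is half-open so that, for [a = 0], the representative has room
    to its right inside [[0, 2 pi]]: [le_Linfty] needs a box of positive volume
    there. *)
Lemma angle_rep (R : realType) (a r : R) :
  exists k : int, a <= r + 2 * pi * k%:~R < a + 2 * pi.
Proof.
have p0 := two_pi_gt0 R.
exists (- Num.floor ((r - a) / (2 * pi))).
have /andP[] := floor_itv ((r - a) / (2 * pi)).
rewrite intrD ler_pdivlMr// ltr_pdivrMr// mulrNz mulrN => H1 H2.
by apply/andP; split; nra.
Qed.

(** The representative never lengthens a coordinate: a maximum of
    [f (x + z) - L |z|] over all increments [z] is thus reached inside the box. *)
Lemma periodic_box (R : realType) (d : nat) (x : 'rV[R]_d) :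
  exists x' : 'rV[R]_d,
    [/\ forall i, `|x' 0 i| <= pi, forall i, `|x' 0 i| <= `|x 0 i|
      & forall f : 'rV[R]_d -> R, periodic f -> f x' = f x].
Proof.
have /choice[k Hk] : forall i : 'I_d, exists k : int,
    `|x 0 i + 2 * pi * k%:~R| <= pi /\ `|x 0 i + 2 * pi * k%:~R| <= `|x 0 i|.
  move=> i; have [le|gt] := leP `|x 0 i| pi.
    by exists 0; rewrite mulr0 addr0.
  have [k /andP[H1 H2]] := angle_rep (- pi) (x 0 i); exists k.
  have H : `|x 0 i + 2 * pi * k%:~R| <= pi by rewrite ler_norml; lra.
  by split=> //; apply: le_trans H (ltW gt).
exists (x + \row_i (2 * pi * (k i)%:~R)); split => [i|i|f pf].
- by rewrite !mxE; case: (Hk i).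
- by rewrite !mxE; case: (Hk i).
- exact: periodic_int.
Qed.

Definition torus_box (R : realType) (d : nat) : set 'rV[R]_d :=
  [set x | forall i, `[- pi, pi]%classic (x 0 i)].

Lemma torus_boxP (R : realType) (d : nat) (x : 'rV[R]_d) :
  torus_box x <-> forall i, `|x 0 i| <= pi.
Proof.
split=> H i; have := H i; rewrite /= ?in_itv /= ler_norml //.
Qed.

Lemma compact_torus_box (R : realType) (d : nat) : compact (@torus_box R d).
Proof.
apply: (@rV_compact _ d (fun=> `[- pi, pi]%classic)) => i.
exact: segment_compact.
Qed.

Lemma torus_box0 (R : realType) (d : nat) : @torus_box R d 0.
Proof. by apply/torus_boxP => i; rewrite mxE normr0 pi_ge0. Qed.

Lemma periodic_bounded (R : realType) (d : nat) (f : 'rV[R]_d -> R) :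
  periodic f -> continuous f -> exists M, forall x, `|f x| <= M.
Proof.
move=> pf cf.
have cn : {within @torus_box R d, continuous (fun x => `|f x|)}.
  apply: continuous_subspaceT => x.
  by apply: (continuous_comp (cf x)); exact: norm_continuous.
have [c _ Hc] := compact_EVT_max (ex_intro _ _ (@torus_box0 R d))
  (@compact_torus_box R d) cn.
exists `|f c| => x; have [x' [x1 _ x2]] := periodic_box x.
by rewrite -(x2 _ pf); apply: Hc; rewrite inE; apply/torus_boxP.
Qed.

Lemma periodic_translate (R : realType) (d : nat) (f : 'rV[R]_d -> R) w :
  periodic f -> periodic (fun x => f (x + w)).
Proof. by move=> pf x i; rewrite addrAC pf. Qed.

Lemma periodic_partial (R : realType) (d : nat) (i : 'I_d) (f : 'rV[R]_d -> R) :
  periodic f -> periodic (partial i f).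
Proof.
move=> pf x j; rewrite /partial /derive.
by under eq_fun do rewrite /= addrA !pf.
Qed.

Lemma supnorm_ge0 (R : realType) (d : nat) (f : 'rV[R]_d -> R) : 0 <= supnorm f.
Proof.
rewrite /supnorm; have [H|H] := pselect (has_sup (range (fun x => `|f x|))).
  apply: le_trans (normr_ge0 (f 0)) _; apply: sup_upper_bound => //; exact: imageT.
by rewrite sup_out.
Qed.

Lemma le_supnorm (R : realType) (d : nat) (f : 'rV[R]_d -> R) x :
  periodic f -> continuous f -> `|f x| <= supnorm f.
Proof.
move=> pf cf; apply: sup_upper_bound; last exact: imageT.
have [M HM] := periodic_bounded pf cf.
by split; [exists `|f 0|; exact: imageT|exists M => _ [y _ <-]].
Qed.

Lemma le_C2norm (R : realType) (d : nat) (f : 'rV[R]_d -> R) x :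
  periodic f -> continuous f -> `|f x| <= C2norm f.
Proof.
move=> pf cf; apply: le_trans (le_supnorm x pf cf) _.
rewrite /C2norm -addrA lerDl addr_ge0 ?sumr_ge0// => i _.
  exact: supnorm_ge0.
by rewrite sumr_ge0// => j _; exact: supnorm_ge0.
Qed.

(** * Regularity in time *)

(** The C^2 norm dominates the supremum norm, so convergence of the difference
    quotients is uniform in space. *)
Lemma C1_C2_time_derive (R : realType) (d : nat) (T : R)
    (h : R -> 'rV[R]_d -> R) (t e : R) :
  C1_C2 T h -> t \in `[0, T] -> 0 < e ->
  exists2 r : R, 0 < r & forall s x, s \in `[0, T] -> s != t -> `|s - t| < r ->
    `|(s - t)^-1 * (h s x - h t x) - dt T h t x| < e.
Proof.
move=> hC tT e0; have [[pt [ct _]] [pd [cd _]] H _] := hC t tT.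
have /cvgrPdist_lt/(_ e e0) := H.
rewrite near_withinE => /nbhs_ballP[r /= r0 Hr].
exists r => // s x sT st str.
have [[ps [cs _]] _ _ _] := hC s sT.
have := Hr s; rewrite -ball_normE /= distrC => /(_ str st sT).
rewrite sub0r normrN => Hs.
apply: le_lt_trans Hs; apply: le_trans (ler_norm _).
apply: (le_C2norm x (f := diff_quot h t s \- dt T h t)).
  by move=> y i; rewrite /= /diff_quot ps pt pd.
move=> y; have cst : {for y, continuous (fun z => h s z - h t z)}.
  by apply: continuousB; [exact: cs|exact: ct].
apply: (@continuousB _ _ _ (diff_quot h t s) (dt T h t)); last exact: cd.
rewrite /diff_quot; apply: (continuousM _ cst); exact: cst_continuous.
Qed.

(** The difference quotients are bounded near [t], uniformly in [x], because
    they are uniformly close to the bounded function [dt T h t]. *)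
Lemma C1_C2_time_continuous (R : realType) (d : nat) (T : R)
    (h : R -> 'rV[R]_d -> R) (t e : R) :
  C1_C2 T h -> t \in `[0, T] -> 0 < e ->
  exists2 r : R, 0 < r & forall s x, s \in `[0, T] -> `|s - t| < r ->
    `|h s x - h t x| < e.
Proof.
move=> hC tT e0; have [_ [pd [cd _]] _ _] := hC t tT.
have [M HM] := periodic_bounded pd cd.
have M0 : 0 <= M by apply: le_trans (HM 0).
have M1 : 0 < M + 1 by lra.
have [r r0 Hr] := C1_C2_time_derive hC tT ltr01.
exists (Num.min r (e / (M + 1))); first by rewrite lt_min r0 divr_gt0.
move=> s x sT; rewrite lt_min => /andP[s1 s2].
have [->|st] := eqVneq s t; first by rewrite subrr normr0.
have st0 : s - t != 0 by rewrite subr_eq0.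
have q1 : `|(s - t)^-1 * (h s x - h t x)| < M + 1.
  have := Hr s x sT st s1; have := HM x.
  rewrite ltr_norml ltr_norml ler_norml; lra.
have -> : h s x - h t x = (s - t) * ((s - t)^-1 * (h s x - h t x)).
  by rewrite mulVKf.
rewrite normrM; move: s2; rewrite ltr_pdivlMr// => s2.
have s_gt0 : 0 < `|s - t| by rewrite normr_gt0.
by apply: lt_trans s2; rewrite ltr_pM2l.
Qed.

Lemma C1_C2_within_continuous (R : realType) (d : nat) (T : R)
    (h : R -> 'rV[R]_d -> R) (t : R) (x : 'rV[R]_d) :
  C1_C2 T h -> t \in `[0, T] ->
  forall e, 0 < e -> exists2 r, 0 < r & forall s y, s \in `[0, T] ->
    `|s - t| < r -> `|y - x| < r -> `|h s y - h t x| < e.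
Proof.
move=> hC tT e e0; have [[_ [ct _]] _ _ _] := hC t tT.
have e2 : 0 < e / 2 by lra.
have [r r0 Hr] := C1_C2_time_continuous hC tT e2.
have /cvgrPdist_lt/(_ _ e2)/nbhs_ballP[q /= q0 Hq] := ct x.
exists (Num.min r q); first by rewrite lt_min r0.
move=> s y sT; rewrite !lt_min => /andP[s1 _] /andP[_ y1].
have A := Hr s y sT s1.
have B : `|h t x - h t y| < e / 2.
  by apply: Hq; rewrite -ball_normE /= distrC.
rewrite distrC in B; rewrite -(subrKA (h t y)).
by apply: le_lt_trans (ler_normD _ _) _; lra.
Qed.

(** * The Euclidean norm *)

Lemma enorm_ge0 (R : realType) (d : nat) (v : 'rV[R]_d) : 0 <= enorm v.
Proof. exact: sqrtr_ge0. Qed.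

Lemma sqr_enorm (R : realType) (d : nat) (v : 'rV[R]_d) :
  enorm v ^+ 2 = \sum_i v 0 i ^+ 2.
Proof. by rewrite sqr_sqrtr// sumr_ge0// => i _; exact: sqr_ge0. Qed.

Lemma enorm0 (R : realType) (d : nat) : enorm (0 : 'rV[R]_d) = 0.
Proof.
rewrite /enorm big1 ?sqrtr0// => i _.
by rewrite mxE expr0n.
Qed.

Lemma enorm_gt0 (R : realType) (d : nat) (v : 'rV[R]_d) : v != 0 -> 0 < enorm v.
Proof.
move=> v0; rewrite lt_neqAle enorm_ge0 andbT eq_sym; apply: contra_neq v0 => v0.
have := sqr_enorm v; rewrite v0 expr0n /= => /esym/eqP.
rewrite psumr_eq0 => [/allP H|i _]; last exact: sqr_ge0.
apply/rowP => i; rewrite mxE; apply/eqP; rewrite -sqrf_eq0.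
exact: H (mem_index_enum i).
Qed.

Lemma le_enorm (R : realType) (d : nat) (v w : 'rV[R]_d) :
  (forall i, `|v 0 i| <= `|w 0 i|) -> enorm v <= enorm w.
Proof.
move=> vw; rewrite ler_wsqrtr// ler_sum// => i _.
by rewrite -real_normK ?num_real// -[leRHS]real_normK ?num_real// lerXn2r ?nnegrE.
Qed.

Lemma enormZ (R : realType) (d : nat) (c : R) (v : 'rV[R]_d) :
  0 <= c -> enorm (c *: v) = c * enorm v.
Proof.
move=> c0; apply/eqP; rewrite -(@eqrXn2 _ 2) ?mulr_ge0 ?enorm_ge0//.
rewrite exprMn !sqr_enorm mulr_sumr; apply/eqP/eq_bigr => i _.
by rewrite mxE exprMn.
Qed.

(** Expand the sum of the squares of [|v| u_i - |u| v_i]. *)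
Lemma dot_le_enorm (R : realType) (d : nat) (u v : 'rV[R]_d) :
  \sum_i u 0 i * v 0 i <= enorm u * enorm v.
Proof.
have [->|u0] := eqVneq u 0.
  by rewrite enorm0 mul0r big1// => i _; rewrite mxE mul0r.
have [->|v0] := eqVneq v 0.
  by rewrite enorm0 mulr0 big1// => i _; rewrite mxE mulr0.
have a0 := enorm_gt0 u0; have b0 := enorm_gt0 v0.
have : 0 <= \sum_i (enorm v * u 0 i - enorm u * v 0 i) ^+ 2.
  by rewrite sumr_ge0// => i _; exact: sqr_ge0.
have -> : \sum_i (enorm v * u 0 i - enorm u * v 0 i) ^+ 2
  = enorm v ^+ 2 * (\sum_i u 0 i ^+ 2) + enorm u ^+ 2 * (\sum_i v 0 i ^+ 2)
    - 2 * (enorm u * enorm v) * \sum_i u 0 i * v 0 i.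
  rewrite !mulr_sumr -big_split -sumrB /=; apply: eq_bigr => i _; ring.
rewrite -!sqr_enorm => H.
have ab : 0 < 2 * (enorm u * enorm v) by rewrite !mulr_gt0.
by rewrite -(ler_pM2l ab); lra.
Qed.

Lemma continuous_enorm (X : topologicalType) (R : realType) (d : nat)
    (F : X -> 'rV[R]_d) :
  (forall i, continuous (fun x => F x 0 i)) -> continuous (fun x => enorm (F x)).
Proof.
move=> cF; suff cs : continuous (fun x => \sum_i F x 0 i ^+ 2).
  by move=> x; apply: (continuous_comp (cs x)); exact: sqrt_continuous.
apply: continuous_big => [|i _ x].
  by move=> x; exact: add_continuous.
exact: (continuousM (cF i x) (cF i x)).
Qed.

(** * The second-order operator *)

Definition hess (R : realType) (d : nat) (f : 'rV[R]_d -> R) (x : 'rV[R]_d) :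
  'M[R]_d := \matrix_(i, j) partial i (partial j f) x.

Definition qform (R : realType) (d : nat) (M : 'M[R]_d) (v : 'rV[R]_d) : R :=
  \sum_i \sum_j v 0 i * M i j * v 0 j.

Lemma qformB (R : realType) (d : nat) (M N : 'M[R]_d) v :
  qform (M - N) v = qform M v - qform N v.
Proof.
rewrite /qform -sumrB; apply: eq_bigr => i _; rewrite -sumrB.
by apply: eq_bigr => j _; rewrite !mxE; ring.
Qed.

Lemma qform_delta (R : realType) (d : nat) (M : 'M[R]_d) i :
  qform M (delta_mx 0 i) = M i i.
Proof.
rewrite /qform (bigD1 i)//= [X in _ + X]big1 => [|k ki]; last first.
  by rewrite big1// => j _; rewrite !mxE (negbTE ki) /= !mul0r.
rewrite addr0 (bigD1 i)//= [X in _ + X]big1 => [|j ji].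
  by rewrite !mxE !eqxx /= mul1r mulr1 addr0.
by rewrite !mxE (negbTE ji) /= mulr0.
Qed.

(** The contraction [A(p) : M], where [A(p) = (|p|^2 - 1) I + 2 p p^T] is the
    Jacobian matrix of the flux [p |-> (|p|^2 - 1) p]. *)
Definition linearised (R : realType) (d : nat) (p : 'rV[R]_d) (M : 'M[R]_d) : R :=
  (enorm p ^+ 2 - 1) * \tr M + 2 * qform M p.

Lemma linearisedB (R : realType) (d : nat) (p : 'rV[R]_d) (M N : 'M[R]_d) :
  linearised p (M - N) = linearised p M - linearised p N.
Proof. by rewrite /linearised qformB linearB /=; ring. Qed.

(** Nonnegativity of [A(p)], in the form in which the maximum principle uses
    it. *)
Definition elliptic (R : realType) (d : nat) (p : 'rV[R]_d) : Prop :=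
  forall M : 'M[R]_d, (forall v, qform M v <= 0) -> linearised p M <= 0.

Lemma elliptic_ge1 (R : realType) (d : nat) (p : 'rV[R]_d) :
  1 <= enorm p -> elliptic p.
Proof.
move=> p1 M M0; have Mp := M0 p.
have tr0 : \tr M <= 0.
  by rewrite /mxtrace; apply: sumr_le0 => i _; rewrite -qform_delta.
have p2 : 0 <= enorm p ^+ 2 - 1 by rewrite subr_ge0 exprn_ege1.
rewrite /linearised; nra.
Qed.

(** Here [tr M] and the quadratic form of [M] involve the same single entry, so
    that [A(p) : M = (3 p^2 - 1) M]. *)
Lemma elliptic_dim1 (R : realType) (p : 'rV[R]_1) :
  1 / Num.sqrt 3 <= enorm p -> elliptic p.
Proof.
move=> p1 M M0; have := M0 (delta_mx 0 0); rewrite qform_delta => M00.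
rewrite /linearised /qform /mxtrace sqr_enorm !big_ord1.
have s3 : 0 < Num.sqrt (3 : R) by rewrite sqrtr_gt0.
have : 1 <= 3 * enorm p ^+ 2.
  rewrite -(sqr_sqrtr (ler0n R 3)) -exprMn exprn_ege1//.
  by move: p1; rewrite ler_pdivrMr// mulrC.
rewrite sqr_enorm big_ord1; nra.
Qed.

Lemma divergence_flux (R : realType) (d : nat) (f : 'rV[R]_d -> R) x :
  is_Ck 2 f ->
  divergence (fun y => (enorm (grad f y) ^+ 2 - 1) *: grad f y) x
  = linearised (grad f x) (hess f x).
Proof.
move=> [_ Cf].
have Dp i j : is_derive x (delta_mx 0 i) (partial j f) (hess f x i j).
  rewrite mxE; apply: derivableP; have [_ [_ C]] := Cf j; exact: (C i).1.
have Di i : partial i (fun y =>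
    ((enorm (grad f y) ^+ 2 - 1) *: grad f y) 0 i) x =
    (enorm (grad f x) ^+ 2 - 1) * hess f x i i
    + 2 * \sum_j partial i f x * hess f x i j * partial j f x.
  have Ef y : (\sum_j partial j f * partial j f - cst 1) y
      = enorm (grad f y) ^+ 2 - 1.
    rewrite sqr_enorm; change ((\sum_j partial j f * partial j f) y - 1
      = \sum_j grad f y 0 j ^+ 2 - 1).
    by rewrite fct_sumE; congr (_ - _); apply: eq_bigr => j _; rewrite mxE expr2.
  have -> : (fun y => ((enorm (grad f y) ^+ 2 - 1) *: grad f y) 0 i)
    = ((\sum_j partial j f * partial j f) - cst 1) * partial i f.
    by apply/funext => y; rewrite !mxE -Ef.
  have D1 : is_derive x (delta_mx 0 i) (\sum_j partial j f * partial j f)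
     (\sum_j (partial j f x *: hess f x i j + partial j f x *: hess f x i j)).
    exact: (@is_derive_sum _ _ _ d (fun j => partial j f * partial j f)).
  have := is_deriveM (is_deriveB D1 (is_derive_cst (1 : R) x (delta_mx 0 i)))
    (Dp i i).
  move=> H; rewrite [LHS](@derive_val _ _ _ _ _ _ _ H).
  rewrite Ef subr0; congr (_ + _).
  rewrite [LHS]mulr_sumr mulr_sumr; apply: eq_bigr => j _.
  by rewrite /GRing.scale /=; ring.
rewrite /divergence (eq_bigr _ (fun i _ => Di i)) big_split /= -!mulr_sumr.
congr (_ * _ + 2 * _).
by apply: eq_bigr => i _; apply: eq_bigr => j _; rewrite /grad !mxE.
Qed.

(** * Gradient bounds and Lipschitz bounds *)

Lemma is_Ck2_is_Ck1 (R : realType) (d : nat) (f : 'rV[R]_d -> R) :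
  is_Ck 2 f -> is_Ck 1 f.
Proof. by move=> [cf C2]; split=> // i; have [Df [ci _]] := C2 i. Qed.

Lemma derive_le_increment (R : realType) (d : nat) (f : 'rV[R]_d -> R)
    (x v : 'rV[R]_d) (l c : R) :
  is_derive x v f l ->
  (forall s, 0 < s < 1 -> f (x + s *: v) - f x <= s * c) -> l <= c.
Proof.
move=> [D E] H; rewrite leNgt; apply/negP => cl.
have : (fun r : R => r^-1 *: (f (r *: v + x) - f x)) @ 0^' --> l.
  by rewrite -E; exact: D.
have lc : 0 < l - c by lra.
move/cvgrPdist_lt => /(_ _ lc)/nbhs_ballP[r /= r0 Hr].
pose s := Num.min (r / 2) (1 / 2).
have s0 : 0 < s by rewrite lt_min !divr_gt0.
have sr : s < r by rewrite gt_min; apply/orP; left; lra.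
have s1 : s < 1 by rewrite gt_min; apply/orP; right; lra.
have := Hr s; rewrite -ball_normE /= sub0r normrN gtr0_norm// gt_eqF//.
move=> /(_ sr isT); rewrite ltr_norml => /andP[_].
have := H s; rewrite s0 s1 => /(_ isT).
rewrite [x + _]addrC [_ *: (_ - _)]mulrC -ler_pdivrMl// [_^-1 * _]mulrC; lra.
Qed.

(** Along the direction of the gradient itself the derivative is [|grad f|^2],
    while the Lipschitz bound allows at most [L |grad f|]. *)
Lemma grad_le_lipschitz (R : realType) (d : nat) (f : 'rV[R]_d -> R) (L : R) x :
  is_Ck 1 f -> 0 <= L -> (forall x z, f (x + z) - f x <= L * enorm z) ->
  enorm (grad f x) <= L.
Proof.
move=> Cf L0 lip; have D := C1_derive x (grad f x) Cf.
have : \sum_i grad f x 0 i * partial i f x <= L * enorm (grad f x).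
  apply: derive_le_increment D _ => s /andP[/ltW s0 _].
  by apply: le_trans (lip _ _) _; rewrite enormZ// mulrCA.
have -> : \sum_i grad f x 0 i * partial i f x = enorm (grad f x) ^+ 2.
  by rewrite sqr_enorm; apply: eq_bigr => i _; rewrite expr2 {2}/grad mxE.
have [->|/enorm_gt0 g1] := eqVneq (grad f x) 0; first by rewrite enorm0.
by rewrite expr2 ler_pM2r.
Qed.

Lemma lipschitz_of_grad_le (R : realType) (d : nat) (f : 'rV[R]_d -> R) (L : R) :
  is_Ck 1 f -> (forall x, enorm (grad f x) <= L) ->
  forall x z, f (x + z) - f x <= L * enorm z.
Proof.
move=> Cf gL x z.
have [r _] := line_mean_value x 1 (fun y => C1_derive y z Cf).
rewrite scale1r mul1r => ->; set y := x + _.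
have -> : \sum_i z 0 i * partial i f y = \sum_i z 0 i * grad f y 0 i.
  by apply: eq_bigr => i _; rewrite mxE.
apply: le_trans (dot_le_enorm _ _) _.
by rewrite mulrC ler_wpM2r ?enorm_ge0.
Qed.

(** * The maximum principle with doubled variables *)

(** The function [y |-> f (y + z) - f y] has a maximum at [x]; the two
    conclusions are the first- and second-order conditions along every line
    through [x]. *)
Lemma doubling_max_translate (R : realType) (d : nat) (f : 'rV[R]_d -> R)
    (x z : 'rV[R]_d) :
  is_Ck 2 f -> (forall y, f (y + z) - f y <= f (x + z) - f x) ->
  grad f (x + z) = grad f x /\
  forall v, qform (hess f (x + z) - hess f x) v <= 0.
Proof.
move=> Cf fmax; have [_ C2] := Cf; have C1 := is_Ck2_is_Ck1 Cf.
have C1p i : is_Ck 1 (partial i f) by have [_ []] := C2 i.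
pose D1 (w v : 'rV[R]_d) : R := \sum_i v 0 i * partial i f w.
have H v : D1 (x + z) v - D1 x v = 0 /\ qform (hess f (x + z) - hess f x) v <= 0.
  pose g s := f (x + z + s *: v) - f (x + s *: v).
  pose dg s := D1 (x + z + s *: v) v - D1 (x + s *: v) v.
  have Dg (s : R) : is_derive s 1 g (dg s).
    apply: (@is_deriveB _ _ _ (fun s : R => f (x + z + s *: v))
      (fun s : R => f (x + s *: v))); apply: is_derive_line; exact: C1_derive.
  have Dd y : is_derive (0 : R) 1 (fun s : R => D1 (y + s *: v) v)
      (qform (hess f y) v).
    have -> : (fun s : R => D1 (y + s *: v) v)
      = \sum_i (fun s : R => v 0 i * partial i f (y + s *: v)).
      by apply/funext => s; rewrite fct_sumE.
    have -> : qform (hess f y) v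
      = \sum_j v 0 j *: (\sum_i v 0 i * partial i (partial j f) y).
      rewrite /qform exchange_big; apply: eq_bigr => j _ /=.
      rewrite [RHS]mulr_sumr; apply: eq_bigr => i _; rewrite mxE; ring.
    apply: is_derive_sum => j.
    apply: (@is_deriveZ _ _ _ (fun s : R => partial j f (y + s *: v))).
    apply: is_derive_line; rewrite scale0r addr0; exact: C1_derive.
  have Ddg : is_derive (0 : R) 1 dg (qform (hess f (x + z) - hess f x) v).
    by rewrite qformB; apply: is_deriveB.
  have [|dg0 q0] := second_derive_at_max Dg Ddg.
    move=> s; rewrite /g scale0r !addr0; apply: le_trans (fmax _).
    by rewrite addrAC.
  by split=> //; move: dg0; rewrite /dg scale0r !addr0.
split=> [|v]; last by have [] := H v.
apply/rowP => i; rewrite !mxE.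
have [+ _] := H (delta_mx 0 i).
have E w : D1 w (delta_mx 0 i) = partial i f w.
  rewrite /D1 (bigD1 i)//= big1 => [|j ji]; first by rewrite mxE !eqxx mul1r addr0.
  by rewrite mxE (negbTE ji) mul0r.
by rewrite !E => /eqP; rewrite subr_eq0 => /eqP.
Qed.

(** Replacing [z] by [(1 - s) z] lowers the penalty by [s L |z|], so [f] must
    drop at least as much: its slope along [z] is at least [L |z|]. The norm is
    never differentiated. *)
Lemma doubling_max_slope (R : realType) (d : nat) (f : 'rV[R]_d -> R)
    (x z : 'rV[R]_d) (L : R) :
  is_Ck 1 f -> z != 0 ->
  (forall w, f (x + w) - L * enorm w <= f (x + z) - L * enorm z) ->
  L <= enorm (grad f (x + z)).
Proof.
move=> Cf z0 fmax.
have : \sum_i (- z) 0 i * partial i f (x + z) <= - (L * enorm z).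
  apply: (derive_le_increment (C1_derive (x + z) (- z) Cf)) => s /andP[s0 s1].
  have -> : x + z + s *: - z = x + (1 - s) *: z.
    by rewrite scalerBl scale1r scalerN addrA.
  have := fmax ((1 - s) *: z); rewrite enormZ; last by lra.
  by lra.
have -> : \sum_i (- z) 0 i * partial i f (x + z)
    = - \sum_i z 0 i * grad f (x + z) 0 i.
  by rewrite -sumrN; apply: eq_bigr => i _; rewrite !mxE mulNr.
rewrite lerN2 => H; have := le_trans H (dot_le_enorm _ _).
by rewrite [leRHS]mulrC ler_pM2r// enorm_gt0.
Qed.

(** Only times [s < t] are used, so that [t = T] is covered as well. *)
Lemma dt_ge_at_max (R : realType) (d : nat) (T : R) (h : R -> 'rV[R]_d -> R)
    (t e : R) (x y : 'rV[R]_d) :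
  C1_C2 T h -> t \in `[0, T] -> 0 < t ->
  (forall s, s \in `[0, T] -> h s y - h s x - e * s <= h t y - h t x - e * t) ->
  e <= dt T h t y - dt T h t x.
Proof.
move=> hC tT t0 hmax; rewrite leNgt; apply/negP => lte.
pose q := (e - (dt T h t y - dt T h t x)) / 2.
have q0 : 0 < q by rewrite /q; lra.
have [r r0 Hr] := C1_C2_time_derive hC tT q0.
pose k := Num.min (r / 2) t.
have k0 : 0 < k by rewrite lt_min t0 divr_gt0.
have kr : k < r by rewrite gt_min; apply/orP; left; lra.
have kt : k <= t by rewrite ge_min lexx orbT.
have tT2 : t <= T by move: tT; rewrite in_itv /= => /andP[].
have sT : t - k \in `[0, T] by rewrite in_itv /=; apply/andP; split; lra.
have st : t - k != t by rewrite lt_eqF//; lra.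
have E : t - k - t = - k by ring.
have nk : `|t - k - t| < r by rewrite E normrN gtr0_norm.
have := Hr _ x sT st nk; have := Hr _ y sT st nk; have := hmax _ sT.
rewrite E invrN !mulNr => H1.
rewrite !ltr_norml => /andP[_ Hy] /andP[Hx _].
have : e <= k^-1 * (h t y - h t x - (h (t - k) y - h (t - k) x)).
  by rewrite mulrC ler_pdivlMr//; lra.
rewrite /q in Hx Hy; move: Hx Hy; rewrite !mulrBr; lra.
Qed.

Lemma C1_C2_comp_continuous (X : topologicalType) (A : set X) (R : realType)
    (d : nat) (T : R) (h : R -> 'rV[R]_d -> R) (tau : X -> R)
    (q : X -> 'rV[R]_d) :
  C1_C2 T h -> continuous tau -> continuous q ->
  (forall p, A p -> tau p \in `[0, T]) ->
  {within A, continuous (fun p => h (tau p) (q p))}.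
Proof.
move=> hC ct cq tA; apply/subspace_continuousP => p Ap.
apply/cvgrPdist_lt => e e0.
have [r r0 Hr] := C1_C2_within_continuous (q p) hC (tA p Ap) e0.
have /cvgrPdist_lt/(_ r r0) Ht := ct p.
have /cvgrPdist_lt/(_ r r0) Hq := cq p.
rewrite near_withinE; near=> u => Au.
rewrite distrC; apply: Hr; first exact: tA.
  by rewrite distrC; near: u.
by rewrite distrC; near: u.
Unshelve. all: by end_near. Qed.

(** The maximum over the compact set where [x] and [z] lie in the box is a
    maximum over all [x] and [z]: reducing both modulo the period preserves the
    values of [h] and does not increase [|z|]. *)
Lemma doubled_max (R : realType) (d : nat) (T : R) (h : R -> 'rV[R]_d -> R)
    (L e : R) :
  C1_C2 T h -> 0 <= T -> 0 <= L ->
  let Phi t x z := h t (x + z) - h t x - L * enorm z - e * t in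
  exists t x z, t \in `[0, T] /\
    forall t' x' z', t' \in `[0, T] -> Phi t' x' z' <= Phi t x z.
Proof.
move=> hC T0 L0 Phi.
pose A : set (R * ('rV[R]_d * 'rV[R]_d)) :=
  `[0, T]%classic `*` (@torus_box R d `*` @torus_box R d).
pose F (p : R * ('rV[R]_d * 'rV[R]_d)) := Phi p.1 p.2.1 p.2.2.
have A0 : A !=set0.
  exists (0, (0, 0)); split=> //=; last by split; exact: torus_box0.
  by rewrite in_itv /= lexx.
have cA : compact A.
  apply: compact_setX; first exact: segment_compact.
  by apply: compact_setX; exact: compact_torus_box.
have c1 : continuous (fun p : R * ('rV[R]_d * 'rV[R]_d) => p.1).
  by move=> p; exact: cvg_fst.
have c2 : continuous (fun p : R * ('rV[R]_d * 'rV[R]_d) => p.2).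
  by move=> p; exact: cvg_snd.
have c21 : continuous (fun p : R * ('rV[R]_d * 'rV[R]_d) => p.2.1).
  by move=> p; apply: (continuous_comp (c2 p)); exact: cvg_fst.
have c22 : continuous (fun p : R * ('rV[R]_d * 'rV[R]_d) => p.2.2).
  by move=> p; apply: (continuous_comp (c2 p)); exact: cvg_snd.
have tA p : A p -> p.1 \in `[0, T] by case.
have cF : {within A, continuous F}.
  have G1 := C1_C2_comp_continuous hC c1 (fun p => continuousD (c21 p) (c22 p)) tA.
  have G2 := C1_C2_comp_continuous hC c1 c21 tA.
  have G3 : continuous (fun p : R * ('rV[R]_d * 'rV[R]_d) => L * enorm p.2.2).
    have ce : continuous (fun p : R * ('rV[R]_d * 'rV[R]_d) => enorm p.2.2).
      apply: continuous_enorm => i p.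
      apply: (@continuous_comp _ _ _ _ (fun v : 'rV[R]_d => v 0 i) p (c22 p)).
      exact: (@coord_continuous R 1 d 0 i).
    by move=> p; apply: (continuousM _ (ce p)); exact: cst_continuous.
  have G4 : continuous (fun p : R * ('rV[R]_d * 'rV[R]_d) => e * p.1).
    by move=> p; apply: (continuousM _ (c1 p)); exact: cst_continuous.
  have within_cvg (G : R * ('rV[R]_d * 'rV[R]_d) -> R) p :
      {within A, continuous G} -> A p -> G @ within A (nbhs p) --> G p.
    by move=> /subspace_continuousP; exact.
  apply/subspace_continuousP => p Ap.
  have H1 := within_cvg _ p G1 Ap; have H2 := within_cvg _ p G2 Ap.
  have H3 := within_cvg _ p (continuous_subspaceT G3) Ap.
  have H4 := within_cvg _ p (continuous_subspaceT G4) Ap.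
  exact: cvgB (cvgB (cvgB H1 H2) H3) H4.
have [[t [x z]] tA0 Fmax] := compact_EVT_max A0 cA cF.
rewrite inE in tA0; exists t, x, z; split; first by case: tA0.
move=> t' x' z' t'T.
have [[ph _] _ _ _] := hC t' t'T.
have [z1 [z1b z1n z1p]] := periodic_box z'.
have [x1 [x1b _ x1p]] := periodic_box x'.
have Ein : (t', (x1, z1)) \in A.
  by rewrite inE; split=> //=; split; apply/torus_boxP.
apply: le_trans (Fmax _ Ein); rewrite /F /Phi /=.
have -> : h t' (x1 + z1) = h t' (x' + z').
  rewrite (x1p _ (periodic_translate z1 ph)).
  rewrite [x' + z1]addrC [x' + z']addrC.
  exact: (z1p _ (periodic_translate x' ph)).
rewrite (x1p _ ph); have := ler_wpM2l L0 (le_enorm z1n); lra.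
Qed.

(** The term [e t] makes the inequality in time strict, which compensates for
    [A(p)] being only nonnegative; the bound follows as [e] tends to [0]. *)
Lemma lipschitz_propagation (R : realType) (d : nat) (T : R)
    (h : R -> 'rV[R]_d -> R) (L : R) :
  C1_C2 T h -> classical_solution T h -> 0 <= L ->
  (forall p : 'rV[R]_d, L <= enorm p -> elliptic p) ->
  (forall x z, h 0 (x + z) - h 0 x <= L * enorm z) ->
  forall t x z, t \in `[0, T] -> h t (x + z) - h t x <= L * enorm z.
Proof.
move=> hC hsol L0 ell lip0 t x z tT.
have t0 : 0 <= t by move: tT; rewrite in_itv /= => /andP[].
have T0 : 0 <= T by move: tT; rewrite in_itv /= => /andP[]; exact: le_trans.
apply/ler_addgt0Pr => eps eps0.
(* Chosen so that [e * t <= eps]; the denominator is positive even at [t = 0]. *)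
pose e := eps / (t + 1).
have e0 : 0 < e by rewrite divr_gt0//; lra.
have et : e * t <= eps by rewrite /e mulrAC ler_pdivrMr; nra.
suff : h t (x + z) - h t x - L * enorm z - e * t <= 0 by lra.
have [t1 [x1 [z1 [t1T Pmax]]]] := doubled_max e hC T0 L0.
apply: le_trans (Pmax t x z tT) _; rewrite leNgt; apply/negP => Ppos.
have t1_ge0 : 0 <= t1 by move: t1T; rewrite in_itv /= => /andP[].
have t1_gt0 : 0 < t1.
  rewrite lt_neqAle t1_ge0 andbT; apply/eqP => t10.
  by move: Ppos; rewrite -t10 mulr0; have := lip0 x1 z1; lra.
have z1_neq0 : z1 != 0.
  apply/eqP => z10; move: Ppos; rewrite z10 addr0 subrr enorm0; nra.
have [[_ C2h] _ _ _] := hC t1 t1T.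
have C1h := is_Ck2_is_Ck1 C2h.
have [Egrad Hneg] : grad (h t1) (x1 + z1) = grad (h t1) x1 /\
    forall v, qform (hess (h t1) (x1 + z1) - hess (h t1) x1) v <= 0.
  by apply: doubling_max_translate => // y; have := Pmax t1 y z1 t1T; lra.
have slope : L <= enorm (grad (h t1) (x1 + z1)).
  by apply: doubling_max_slope => // w; have := Pmax t1 x1 w t1T; lra.
have : e <= dt T h t1 (x1 + z1) - dt T h t1 x1.
  by apply: dt_ge_at_max => // s sT; have := Pmax s x1 z1 sT; lra.
rewrite !hsol// !divergence_flux// -Egrad -linearisedB => e_le.
have := lt_le_trans e0 (le_trans e_le (ell _ slope _ Hneg)).
by rewrite ltxx.
Qed.

(** * Essential suprema on the torus *)

Lemma uniform_prob_itv_gt0 (R : realType) (a b : R) :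
  0 <= a -> a < b -> b <= 2 * pi ->
  (0 < uniform_prob (two_pi_gt0 R) `[a, b]%classic)%E.
Proof.
move=> a0 ab bpi; have p0 := two_pi_gt0 R.
rewrite /uniform_prob (@eq_integral _ _ _ _ _ (cst ((2 * pi)^-1)%:E)).
  rewrite integral_cst//= lebesgue_measure_itv/= lte_fin ab -EFinB -EFinM lte_fin.
  by rewrite mulr_gt0 ?invr_gt0 ?subr_gt0.
move=> x; rewrite inE /= in_itv /= => /andP[ax xb].
by rewrite /uniform_pdf subr0 (le_trans a0 ax) (le_trans xb bpi).
Qed.

Definition tuple_box (R : realType) (d : nat) (a b : 'I_d -> R) :
  set (d.-tuple (measurableTypeR R)) := [set u | forall i, a i <= tnth u i <= b i].

Lemma measurable_tuple_box (R : realType) (d : nat) (a b : 'I_d -> R) :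
  measurable (tuple_box a b).
Proof.
have -> : tuple_box a b = \bigcap_(i in [set: 'I_d])
    ((fun u : d.-tuple (measurableTypeR R) => tnth u i) @^-1` `[a i, b i]%classic).
  apply/seteqP; split => u /= H i.
    by move=> _; have := H i; rewrite /= in_itv.
  by have := H i I; rewrite /= in_itv.
apply: fin_bigcap_measurable => // i _; rewrite -[X in measurable X]setTI.
exact: measurable_tnth.
Qed.

Lemma torus_measure_box_gt0 (R : realType) (d : nat) (a b : 'I_d -> R) :
  (forall i, 0 <= a i) -> (forall i, a i < b i) -> (forall i, b i <= 2 * pi) ->
  (0 < torus_measure R d (tuple_box a b))%E.
Proof.
elim: d a b => [|n IH] a b a0 ab bpi.
  rewrite /= diracE mem_set ?lte_fin//; by case.
rewrite /= /distribution /pushforward /=.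
have -> : @cons_pair R n @^-1` tuple_box a b =
    `[a ord0, b ord0]%classic `*`
    tuple_box (fun i => a (lift ord0 i)) (fun i => b (lift ord0 i)).
  apply/seteqP; split => -[r u] /=.
    move=> H; split; first by have := H ord0; rewrite /= in_itv /= tnth0.
    by move=> i; have := H (lift ord0 i); rewrite tnthS.
  move=> [+ H]; rewrite in_itv /= => Hr i.
  by have [j ->|->] := unliftP ord0 i; rewrite ?tnthS ?tnth0 //; exact: H.
rewrite product_measure1E//; last exact: measurable_tuple_box.
by rewrite mule_gt0// ?uniform_prob_itv_gt0// IH.
Qed.

Lemma Linfty_ess_sup (R : realType) (d : nat) (f : 'rV[R]_d -> R) :
  Linfty f = ess_sup (torus_measure R d)
    (abse \o (fun u => (f (\row_i tnth u i))%:E)).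
Proof.
have T1 : (0 < torus_measure R d [set: _])%E by rewrite probability_setT lte01.
rewrite /Linfty unlock; case: ifPn => // /negP[]; exact: T1.
Qed.

Lemma Linfty_le (R : realType) (d : nat) (f : 'rV[R]_d -> R) (M : R) :
  (forall x, `|f x| <= M) -> (Linfty f <= M%:E)%E.
Proof.
move=> fM; rewrite Linfty_ess_sup.
by apply/ess_supP; apply: nearW => u /=; rewrite lee_fin.
Qed.

(** Otherwise [|f|] exceeds its essential supremum on a neighbourhood of a
    point, and this neighbourhood contains a box of positive measure. *)
Lemma le_Linfty (R : realType) (d : nat) (f : 'rV[R]_d -> R) x :
  periodic f -> continuous f -> (`|f x|%:E <= Linfty f)%E.
Proof.
move=> pf cf; rewrite leNgt; apply/negP.
rewrite Linfty_ess_sup.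
set g := abse \o _ => gx.
have p0 := two_pi_gt0 R.
have [x' x'b x'f] : exists2 x' : 'rV[R]_d,
    forall i, 0 <= x' 0 i < 2 * pi & f x' = f x.
  have /choice[k Hk] : forall i : 'I_d, exists k : int,
    0 <= x 0 i + 2 * pi * k%:~R < 0 + 2 * pi by move=> i; exact: angle_rep.
  exists (x + \row_i (2 * pi * (k i)%:~R)); last exact: periodic_int.
  by move=> i; rewrite !mxE; have := Hk i; rewrite add0r.
have [N [mN N0 HN]] := ess_sup_ge (torus_measure R d) g.
have : \forall y \near x', (ess_sup (torus_measure R d) g < `|f y|%:E)%E.
  (* The essential supremum is a priori an extended real. *)
  have [r [gr rf]] : exists r : R,
      (ess_sup (torus_measure R d) g <= r%:E)%E /\ r < `|f x'|.
    rewrite x'f; move: gx; case: (ess_sup _ _) => [r|//|_].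
      by rewrite lte_fin => rf; exists r.
    by exists (`|f x| - 1); split; [exact: leNye|lra].
  have cn : (fun y => `|f y|) @ x' --> `|f x'|.
    by apply: (continuous_comp (cf x')); exact: norm_continuous.
  near=> y; have ry : r < `|f y| by near: y; exact: cvgr_gt cn _ rf.
  by apply: le_lt_trans gr _; rewrite lte_fin.
move=> /nbhs_ballP[r /= r0 Hr].
(* [x'] may lie on a lower face of the fundamental domain, so it is taken as the
   lowest corner of the box. *)
pose b i := Num.min (x' 0 i + r / 2) (2 * pi).
have : (0 < torus_measure R d (tuple_box (fun i => x' 0%R i) b))%E.
  apply: torus_measure_box_gt0 => i.
  - by have /andP[] := x'b i.
  - by have /andP[_ H] := x'b i; rewrite /b lt_min H andbT; lra.
  - by rewrite /b ge_min lexx orbT.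
rewrite ltNge => /negP; apply; rewrite -N0; apply: le_measure.
- by rewrite inE; exact: measurable_tuple_box.
- by rewrite inE.
move=> u Hu; apply: HN => /= H.
have := Hr (\row_i tnth u i); rewrite -ball_normE /=.
have Hb : `|x' - \row_i tnth u i| < r.
  have : `|x' - \row_i tnth u i| <= r / 2.
    rewrite [`|_|]mx_normrE; apply/bigmax_leP; split; first by lra.
    move=> [i j] _ /=; rewrite !mxE !ord1.
    have := Hu j; rewrite /b le_min ler_norml => /andP[h1 /andP[h2 _]].
    lra.
  lra.
by move=> /(_ Hb); rewrite ltNge => /negP; apply; exact: H.
Unshelve. all: by end_near. Qed.

(** * The gradient bound *)

(** Lipschitz bounds are what propagates in time; gradients enter only at the
    initial and at the final time. *)
Lemma gradient_propagation (R : realType) (d : nat) (T : R)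
    (h : R -> 'rV[R]_d -> R) (L : R) :
  C1_C2 T h -> classical_solution T h -> 0 <= L ->
  (forall p : 'rV[R]_d, L <= enorm p -> elliptic p) ->
  (forall x, enorm (grad (h 0) x) <= L) ->
  forall t x, t \in `[0, T] -> enorm (grad (h t) x) <= L.
Proof.
move=> hC hsol L0 ell g0 t x tT.
have T0 : 0 <= T by move: tT; rewrite in_itv /= => /andP[]; exact: le_trans.
have C1h s : s \in `[0, T] -> is_Ck 1 (h s).
  by move=> sT; have [[_ /is_Ck2_is_Ck1]] := hC s sT.
have zT : 0 \in `[0, T] by rewrite in_itv /= lexx.
apply: grad_le_lipschitz => // [|y z]; first exact: C1h.
apply: (lipschitz_propagation hC hsol L0 ell _ _ _ tT).
exact: lipschitz_of_grad_le (C1h _ zT) g0.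
Qed.

(** Turns an implication between pointwise bounds into one between L^oo norms;
    when the norm of [f] is infinite the claim is void. *)
Lemma Linfty_le_max (R : realType) (d : nat) (f g : 'rV[R]_d -> R) (c : R) :
  periodic f -> continuous f ->
  (forall L, c <= L -> (forall x, `|f x| <= L) -> forall x, `|g x| <= L) ->
  (Linfty g <= Order.max (Linfty f) c%:E)%E.
Proof.
move=> pf cf fg; have fL x := le_Linfty x pf cf.
case E : (Linfty f) => [r||].
- rewrite E in fL; rewrite -EFin_max; apply: Linfty_le; apply: fg.
    by rewrite le_max lexx orbT.
  by move=> x; rewrite le_max -lee_fin fL.
- by rewrite max_l ?leey.
- by have := fL 0; rewrite E.
Qed.

Theorem proposition1p1 (R : realType) (d : nat) (T : R)
    (h : R -> 'rV[R]_d -> R)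
    (d_ge1 : (1 <= d)%N) (T_gt0 : 0 < T)
    (h_C1C2 : C1_C2 T h) (h_sol : classical_solution T h) :
  (forall t : R, 0 <= t <= T ->
     (Linfty (fun x => enorm (grad (h t) x))
      <= Order.max (Linfty (fun x => enorm (grad (h 0%R) x))) 1%:E)%E) /\
  (d = 1%N -> forall i : 'I_d, forall t : R, 0 <= t <= T ->
     (Linfty (partial i (h t))
      <= Order.max (Linfty (partial i (h 0%R))) ((1 / Num.sqrt 3)%R)%:E)%E).
Proof.
have T0 : 0 \in `[0, T] by rewrite in_itv /= lexx ltW.
have [[ph [_ C2h]] _ _ _] := h_C1C2 0 T0.
have cp i : continuous (partial i (h 0)) by have [_ []] := C2h i.
split=> [t tT|d1 i t tT].
  apply: Linfty_le_max => [x i||L L1 g0 x].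
  - congr enorm; apply/rowP => j; rewrite !mxE; exact: periodic_partial.
  - apply: continuous_enorm => i.
    have -> : (fun x => grad (h 0) x 0 i) = partial i (h 0).
      by apply/funext => x; rewrite mxE.
    exact: cp.
  rewrite ger0_norm ?enorm_ge0//.
  apply: (gradient_propagation h_C1C2 h_sol); last exact: tT.
  - exact: le_trans ler01 L1.
  - by move=> p Lp; apply: elliptic_ge1; exact: le_trans Lp.
  - by move=> y; have := g0 y; rewrite ger0_norm ?enorm_ge0.
subst d.
have enormE f x : enorm (grad f x) = `|partial i f x|.
  by rewrite /enorm big_ord1 mxE sqrtr_sqr (ord1 i).
apply: Linfty_le_max => [||L L1 g0 x]; first exact: periodic_partial.
  exact: cp.
rewrite -enormE; apply: (gradient_propagation h_C1C2 h_sol); last exact: tT.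
- by apply: le_trans L1; rewrite divr_ge0// sqrtr_ge0.
- by move=> p Lp; apply: elliptic_dim1; exact: le_trans Lp.
- by move=> y; rewrite enormE.
Qed.
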